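(* Let $\Omega\subset\mathbb{R}^n$ be a nonempty open bounded set, let $f:\Omega\times\mathbb{R}\to\mathbb{R}$, and let $u\in C(\Omega)$ be a viscosity solution to $-\Delta_\infty u=f(x,u)$ in $\Omega$. If $u$ is locally semiconcave in $\Omega$, then $u$ is everywhere differentiable (hence of class $C^1$) in $\Omega$.
   Context: For smooth $\varphi$, $\Delta_\infty\varphi:=\langle\nabla^2\varphi\,\nabla\varphi,\nabla\varphi\rangle$. $u\in C(\Omega)$ is a viscosity solution to $-\Delta_\infty u=f(x,u)$ in $\Omega$ if for every $x_0\in\Omega$ and $\varphi\in C^2(\Omega)$: $-\Delta_\infty\varphi(x_0)\le f(x_0,u(x_0))$ whenever $u-\varphi$ has a local maximum at $x_0$, and $-\Delta_\infty\varphi(x_0)\ge f(x_0,u(x_0))$ whenever $u-\varphi$ has a local minimum at $x_0$. A function $u$ is semiconcave with constant $C$ in a set $A$ if $u(\lambda x+(1-\lambda)y)\ge\lambda u(x)+(1-\lambda)u(y)-C\frac{\lambda(1-\lambda)}2|x-y|^2$ for every segment $[x,y]\subset A$ and every $\lambda\in[0,1]$; $u$ is locally semiconcave in $\Omega$ if it is semiconcave (with some constant) on every compact subset of $\Omega$. *)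

(* Defs.v *)
From HB Require Import structures.
From mathcomp Require Import all_boot all_order all_algebra.
From mathcomp Require Import boolp classical_sets functions reals ereal.
From mathcomp Require Import topology normedtype derive.

Set Implicit Arguments.
Unset Strict Implicit.
Unset Printing Implicit Defensive.

Import Order.TTheory GRing.Theory Num.Theory.
Import numFieldNormedType.Exports.

Local Open Scope classical_set_scope.
Local Open Scope ring_scope.

(* R^n is the type of column vectors. Real functions on an open set Omega    *)
(* are represented by total functions 'cV[R]_n -> R. The notions below are    *)
(* meant for open Omega, where they depend only on the values taken on Omega. *)

Section Defs.
Context {R : realType} {n : nat}.
Implicit Types (x y : 'cV[R]_n) (A Omega : set 'cV[R]_n) (phi u : 'cV[R]_n -> R).

(* The norm `|x| that the library puts on matrices is the sup norm: it gives  *)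
(* the usual topology, bounded sets and differentials, but the Euclidean      *)
(* |x|^2 has to be written dot x x.                                           *)
Definition dot x y : R := \sum_(i < n) x i 0 * y i 0.

Definition partial (i : 'I_n) phi : 'cV[R]_n -> R :=
  fun x => 'D_(delta_mx i 0) phi x.

Definition grad phi x : 'cV[R]_n := \col_i partial i phi x.

Definition hessian phi x : 'M[R]_n := \matrix_(i, j) partial j (partial i phi) x.

Definition infty_laplacian phi x : R := dot (hessian phi x *m grad phi x) (grad phi x).

Fixpoint class_C (k : nat) Omega phi : Prop :=
  match k with
  | 0%N => {within Omega, continuous phi}
  | k'.+1 => (forall x, Omega x -> differentiable phi x) /\
             (forall i : 'I_n, class_C k' Omega (partial i phi))
  end.

Definition has_local_max (g : 'cV[R]_n -> R) x := \forall y \near x, g y <= g x.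

Definition has_local_min (g : 'cV[R]_n -> R) x := \forall y \near x, g x <= g y.

Definition viscosity_solution Omega (f : 'cV[R]_n -> R -> R) u : Prop :=
  class_C 0 Omega u /\
  forall x0 phi, Omega x0 -> class_C 2 Omega phi ->
    (has_local_max (u \- phi) x0 -> - infty_laplacian phi x0 <= f x0 (u x0)) /\
    (has_local_min (u \- phi) x0 -> f x0 (u x0) <= - infty_laplacian phi x0).

Definition segment x y : set 'cV[R]_n :=
  [set l *: x + (1 - l) *: y | l in [set l : R | 0 <= l <= 1]].

Definition semiconcave (C : R) A u : Prop :=
  forall x y, segment x y `<=` A ->
  forall l : R, 0 <= l <= 1 ->
    l * u x + (1 - l) * u y - C * (l * (1 - l) / 2) * dot (x - y) (x - y)
      <= u (l *: x + (1 - l) *: y).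

Definition locally_semiconcave Omega u : Prop :=
  forall K : set 'cV[R]_n, compact K -> K `<=` Omega ->
    exists C : R, semiconcave C K u.

End Defs.

(* Main.v *)
(* Write u = (C/2)|x - x0|^2 - w with w convex near x0. If w had two distinct
   subgradients m + d, m - d at x0, then w(x) - w(x0) >= <m, x - x0> + |<d, x - x0>|,
   so for |s| <= 1/2 and every k > 0 the quadratic polynomial
     <s d - m, x - x0> + (C/2)|x - x0|^2 - (k/2)<d, x - x0>^2
   touches u - u(x0) from above at x0. Choosing s with <d, s d - m> <> 0, its
   infinity Laplacian at x0 tends to -oo as k grows, against the subsolution
   inequality, whose right-hand side f(x0, u(x0)) is fixed. Hence the subgradient
   is unique, which for a convex function means differentiability. The gradient
   is continuous because each directional derivative is an infimum of difference
   quotients, hence upper semicontinuous, for both directions v and -v. *)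
Require Import Defs.
From HB Require Import structures.
From mathcomp Require Import all_boot all_order all_algebra.
From mathcomp Require Import boolp classical_sets functions reals ereal.
From mathcomp Require Import topology normedtype derive.
From mathcomp Require Import landau ring lra.
Import Order.TTheory GRing.Theory Num.Theory.
Import numFieldNormedType.Exports.
Local Open Scope classical_set_scope.
Local Open Scope ring_scope.

(** * Algebra of the Euclidean inner product *)

Section Dot.
Context {R : realType} {n : nat}.
Implicit Types (x y z : 'cV[R]_n).

Lemma dotC x y : dot x y = dot y x.
Proof. by apply: eq_bigr => i _; rewrite mulrC. Qed.

Lemma dotDr x y z : dot x (y + z) = dot x y + dot x z.
Proof. by rewrite -big_split; apply: eq_bigr => i _; rewrite mxE mulrDr. Qed.

Lemma dotZr x (t : R) y : dot x (t *: y) = t * dot x y.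
Proof. by rewrite mulr_sumr; apply: eq_bigr => i _; rewrite mxE mulrCA. Qed.

Lemma dotNr x y : dot x (- y) = - dot x y.
Proof. by rewrite -scaleN1r dotZr mulN1r. Qed.

Lemma dotBr x y z : dot x (y - z) = dot x y - dot x z.
Proof. by rewrite dotDr dotNr. Qed.

Lemma dotDl x y z : dot (y + z) x = dot y x + dot z x.
Proof. by rewrite dotC dotDr 2!(dotC x). Qed.

Lemma dotZl x (t : R) y : dot (t *: y) x = t * dot y x.
Proof. by rewrite dotC dotZr dotC. Qed.

Lemma dotNl x y : dot (- y) x = - dot y x.
Proof. by rewrite dotC dotNr dotC. Qed.

Lemma dotBl x y z : dot (y - z) x = dot y x - dot z x.
Proof. by rewrite dotDl dotNl. Qed.

Lemma dot0r x : dot x 0 = 0.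
Proof. by rewrite -(scale0r 0) dotZr mul0r. Qed.

Lemma dot_delta x i : dot x (delta_mx i 0) = x i 0.
Proof.
rewrite /dot (bigD1 i) //= mxE !eqxx mulr1 big1 ?addr0// => j jNi.
by rewrite mxE (negbTE jNi) mulr0.
Qed.

Lemma dot_eq0 x : dot x x = 0 -> x = 0.
Proof.
move/eqP; rewrite psumr_eq0; last by move=> i _; rewrite -expr2 sqr_ge0.
move=> /allP x0; apply/colP => i; rewrite mxE.
by have := x0 i (mem_index_enum _); rewrite /= mulf_eq0 orbb => /eqP.
Qed.

(** [x *m y^T] is the rank-one map sending [z] to [<y, z> x]. Such a term appears in the Hessian of
    the test polynomial. *)
Lemma dot_mulmx_trmx x y z : dot (x *m y^T *m z) z = dot x z * dot y z.
Proof.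
have -> : x *m y^T *m z = dot y z *: x.
  rewrite -mulmxA; apply/colP => i; rewrite !mxE big_ord1 !mxE mulrC.
  by congr (_ * _); apply: eq_bigr => j _; rewrite mxE.
by rewrite dotZl mulrC.
Qed.

Lemma col_sum_delta x : x = \sum_i x i 0 *: delta_mx i 0.
Proof.
rewrite [LHS]matrix_sum_delta; apply: eq_bigr => i _.
by rewrite big_ord1.
Qed.

End Dot.

(** * Sublinear functionals and their flattening *)

(** Homogeneity is asked as an inequality only, which is easier to check for infima; using it for
    [t^-1] as well gives equality. *)
Definition sublinear {R : realType} {V : lmodType R} (P : V -> R) :=
  (forall (t : R) v, 0 < t -> P (t *: v) <= t * P v) /\
  (forall v w, P (v + w) <= P v + P w).

Section Sublinear.
Context {R : realType} {V : lmodType R}.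
Implicit Types (P Q : V -> R) (v w : V).

Lemma sublinearZ P (t : R) v : sublinear P -> 0 < t -> P (t *: v) = t * P v.
Proof.
move=> [Ph _] t0; apply/eqP; rewrite eq_le Ph//= -ler_pdivlMl//.
have := Ph t^-1 (t *: v); rewrite invr_gt0 => /(_ t0).
by rewrite scalerA mulVf ?gt_eqF// scale1r.
Qed.

Lemma sublinear0 P : sublinear P -> P 0 = 0.
Proof.
move=> sP; have := sublinearZ P 2 0 sP; rewrite scaler0 ltr0n => /(_ isT); lra.
Qed.

Lemma sublinear_oppr P v : sublinear P -> 0 <= P v + P (- v).
Proof. by move=> sP; rewrite -(sublinear0 P sP) -(subrr v); apply: sP.2. Qed.

(* An infimum of a family of values that is conical and subadditive as a whole
   is sublinear; [S 0 >= 0] is what keeps all the infima finite. *)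
Lemma sublinear_inf (S : V -> set R) :
  (forall v, S v !=set0) -> (forall s, S 0 s -> 0 <= s) ->
  (forall (t : R) v s, 0 < t -> S v s -> S (t *: v) (t * s)) ->
  (forall v w s s', S v s -> S w s' -> exists2 r, S (v + w) r & r <= s + s') ->
  (forall v, has_inf (S v)) /\ sublinear (fun v => inf (S v)).
Proof.
move=> S0 Sge0 Sh Sa.
have Slb v : has_inf (S v).
  split; first exact: S0.
  have [s' s'S] := S0 (- v); exists (- s') => s sS.
  have [r] := Sa _ _ _ _ sS s'S; rewrite subrr => /Sge0; lra.
split=> //; split=> [t v t0|v w].
  rewrite -ler_pdivrMl//=; apply: lb_le_inf => // s sS.
  rewrite ler_pdivrMl//; apply: ge_inf; [exact: (Slb _).2|exact: Sh].
rewrite /= -lerBlDr; apply: lb_le_inf => // s sS.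
rewrite lerBlDr [s + _]addrC -lerBlDr; apply: lb_le_inf => // s' s'S.
have [r rS rs] := Sa _ _ _ _ sS s'S.
have := ge_inf (Slb (v + w)).2 rS; lra.
Qed.

(** One step of Hahn-Banach: [Q w] is the infimum of [P (w + t v) - t P v] over [t >= 0]. Taking
    [t = 0] gives [Q <= P], and [t = 1] at [w = - v] gives the bound on [Q (- v)]. *)
Lemma sublinear_flatten P v : sublinear P ->
  exists Q, [/\ sublinear Q, forall w, Q w <= P w & Q (- v) <= - P v].
Proof.
move=> sP; have [Ph Pa] := sP.
pose S w := [set P (w + t *: v) - t * P v | t in [set t : R | 0 <= t]].
have [||||Slb sQ] := sublinear_inf S.
- by move=> w; exists (P (w + 0 *: v) - 0 * P v), 0 => /=.
- move=> _ [t /= t0 <-]; rewrite add0r; move: t0; rewrite le_eqVlt => /predU1P[<-|t0].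
    by rewrite scale0r sublinear0// mul0r subrr.
  by rewrite sublinearZ// subrr.
- move=> t w _ t0 [r /= r0 <-]; exists (t * r) => /=; first by rewrite mulr_ge0// ltW.
  by rewrite -scalerA -scalerDr sublinearZ// mulrBr mulrA.
- move=> w w' _ _ [t /= t0 <-] [t' /= t'0 <-].
  exists (P (w + w' + (t + t') *: v) - (t + t') * P v).
    by exists (t + t') => //=; rewrite addr_ge0.
  by have := Pa (w + t *: v) (w' + t' *: v); rewrite addrACA -scalerDl; lra.
exists (fun w => inf (S w)); split=> // [w|].
  apply: ge_inf; first exact: (Slb _).2.
  by exists 0 => //=; rewrite scale0r addr0 mul0r subr0.
apply: ge_inf; first exact: (Slb _).2.
by exists 1 => //=; rewrite scale1r addNr sublinear0// mul1r sub0r.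
Qed.

(** Later flattenings only lower the functional, so flatness along [v] survives them:
    [Q (- v) <= P1 (- v) <= - P v <= - Q v]. *)
Lemma sublinear_flatten_seq (s : seq V) P : sublinear P ->
  exists Q, [/\ sublinear Q, forall w, Q w <= P w &
    {in s, forall w, Q (- w) <= - Q w}].
Proof.
elim: s => [|v s IH] in P * => sP; first by exists P.
have [P1 [sP1 P1P P1v]] := sublinear_flatten P v sP.
have [Q [sQ QP1 Qs]] := IH P1 sP1.
exists Q; split=> // [w|w]; first exact: le_trans (QP1 w) (P1P w).
rewrite inE => /predU1P[->|/Qs//].
apply: le_trans (QP1 _) (le_trans P1v _).
by rewrite lerN2 (le_trans (QP1 _)).
Qed.
End Sublinear.

(** * Supporting linear functionals *)

Section Support.
Context {R : realType} {n : nat}.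
Implicit Types (P : 'cV[R]_n -> R) (p v w : 'cV[R]_n).

(* Hahn-Banach in finite dimension: flatten [P] along [v] and then along every
   coordinate axis; what remains is linear. *)
Lemma sublinear_support P v : sublinear P ->
  exists p, (forall w, dot p w <= P w) /\ dot p v = P v.
Proof.
move=> sP; have [P1 [sP1 P1P P1v]] := sublinear_flatten P v sP.
have [Q [sQ QP1 Qd]] := sublinear_flatten_seq
  [seq delta_mx i (0 : 'I_1) | i <- enum 'I_n] P1 sP1.
pose p : 'cV[R]_n := \col_i Q (delta_mx i 0).
(* For negative [c] this is where flatness along the axis enters. *)
have Qc c i : Q (c *: delta_mx i 0) <= c * p i 0.
  rewrite mxE; have [c0|c0|->] := ltgtP c 0.
  - rewrite -[c]opprK scaleNr -scalerN mulNr -mulrN.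
    apply: le_trans (sQ.1 _ _ _) _; first by rewrite oppr_gt0.
    rewrite ler_pM2l ?oppr_gt0// Qd//; apply/mapP; exists i => //.
    exact: mem_enum.
  - exact: sQ.1.
  - by rewrite scale0r sublinear0// mul0r.
have Qp w : Q w <= dot p w.
  rewrite {1}[w]col_sum_delta /dot.
  elim/big_ind2: _ => [|x1 x2 y1 y2 h1 h2|i _]; first by rewrite sublinear0.
    exact: le_trans (sQ.2 _ _) (lerD h1 h2).
  by rewrite mulrC.
have pQ w : dot p w <= Q w.
  by have := sublinear_oppr _ w sQ; have := Qp (- w); rewrite dotNr; lra.
exists p; split=> [w|]; first exact: le_trans (pQ w) (le_trans (QP1 w) (P1P w)).
(* The initial flattening along [v] gives [<p, - v> <= P1 (- v) <= - P v], which is the missing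
   inequality. *)
apply/eqP; rewrite eq_le (le_trans (pQ v) (le_trans (QP1 v) (P1P v)))/=.
by have := pQ (- v); have := QP1 (- v); rewrite dotNr; lra.
Qed.

End Support.

(** * Convex functions and their difference quotients *)

(** Convexity of the domain [K] is part of the notion. *)
Definition convex_on {R : realType} {V : lmodType R} (K : set V) (g : V -> R) :=
  forall x y (l : R), K x -> K y -> 0 <= l <= 1 ->
    K (l *: x + (1 - l) *: y) /\
    g (l *: x + (1 - l) *: y) <= l * g x + (1 - l) * g y.

Section Slopes.
Context {R : realType} {V : normedModType R}.
Implicit Types (K : set V) (g : V -> R) (v w : V).

(* Only [t] with [t *: v] in [K] is allowed, so that no step size has to be fixed;
   for convex [g] with [g 0 = 0] the infimum is the directional derivative. *)
Definition slopes K g v : set R :=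
  [set g (t *: v) / t | t in [set t : R | 0 < t /\ K (t *: v)]].

Lemma slopes_neq0 K g v : nbhs 0 K -> slopes K g v !=set0.
Proof.
move=> K0; have : \forall t \near (0 : R)^'+, K (t *: v).
  have /cvg_at_right_filter : (t *: v) @[t --> (0 : R)] --> (0 : V).
    by rewrite -[X in _ --> X](scale0r v); exact: scalel_continuous.
  exact.
move=> K0'; have [t [t0 Kt]] : exists t : R, 0 < t /\ K (t *: v).
  near (0 : R)^'+ => t; exists t; split; near: t; first exact: nbhs_right_gt.
  exact: K0'.
by exists (g (t *: v) / t), t.
Unshelve. all: by end_near. Qed.

(** For subadditivity, [t v] and [s w] with weights [s / (t + s)] and [t / (t + s)] combine to
    [v + w] scaled by [t s / (t + s)]; by convexity the quotient there is at most the sum of the two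
    given ones. *)
Lemma inf_slopes_sublinear K g :
  convex_on K g -> nbhs 0 K -> g 0 = 0 ->
  (forall v, has_inf (slopes K g v)) /\ sublinear (fun v => inf (slopes K g v)).
Proof.
move=> cg K0 g0; apply: sublinear_inf => [v|_ [t [t0 _] <-]|t v _ t0 [s [s0 Ks] <-]|].
- exact: slopes_neq0.
- by rewrite scaler0 g0 mul0r.
- exists (s / t) => /=; last by rewrite scalerA divfK ?gt_eqF//; field; lra.
  by rewrite divr_gt0// scalerA divfK ?gt_eqF.
- move=> v w _ _ [t [t0 Kt] <-] [s [s0 Ks] <-].
  have ts0 : 0 < t + s by rewrite addr_gt0.
  have l01 : 0 <= s / (t + s) <= 1.
    by rewrite ler_pdivrMr// mul1r lerDr divr_ge0 ltW.
  have [Kts gts] := cg _ _ _ Kt Ks l01.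
  have tsE : t * s / (t + s) *: (v + w) =
      s / (t + s) *: (t *: v) + (1 - s / (t + s)) *: (s *: w).
    by rewrite scalerDr !scalerA; congr (_ *: _ + _ *: _); field; lra.
  exists (g (t * s / (t + s) *: (v + w)) / (t * s / (t + s))).
    by exists (t * s / (t + s)) => //=; rewrite tsE divr_gt0 ?mulr_gt0.
  rewrite tsE ler_pdivrMr; last by rewrite divr_gt0 ?mulr_gt0.
  apply: le_trans gts _; rewrite le_eqVlt; apply/orP; left; apply/eqP.
  field; lra.
Qed.

(** Convexity bounds the quotient at any step [h <= t] by the one at [t]; then [h] tends to [0] from
    the right. *)
Lemma convex_derive_le K g x v (t : R) : convex_on K g -> derivable g x v ->
  0 < t -> K x -> K (x + t *: v) -> 'D_v g x <= (g (x + t *: v) - g x) / t.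
Proof.
move=> cg dg t0 Kx Kxv; have /cvg_dnbhs_at_right dg' := dg.
apply: (@cvgr_to_le _ _ _ _ _ _ _ dg').
near=> h.
have h0 : 0 < h by near: h; exact: nbhs_right_gt.
have ht : h <= t by near: h; exact: nbhs_right_le.
have l01 : 0 <= h / t <= 1 by rewrite ler_pdivrMr// mul1r ht divr_ge0// ltW.
have [_] := cg _ _ _ Kxv Kx l01.
rewrite scalerDr addrAC -scalerDl subrKC scale1r scalerA divfK ?gt_eqF//.
rewrite /GRing.scale/= ler_pdivrMl//.
rewrite [h *: v + x]addrC mulrCA mulrAC; lra.
Unshelve. all: by end_near. Qed.

End Slopes.

(** * From bounds along rays to a uniform little-o bound *)

Section Convex_littleo.
Context {R : realType} {n : nat}.
Implicit Types (K : set 'cV[R]_n) (h : 'cV[R]_n -> R).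

Lemma normr_coord_le (v : 'cV[R]_n) i : `|v i 0| <= `|v|.
Proof.
rewrite [leRHS]/Num.Def.normr /= mx_normrE.
exact: (le_bigmax _ (fun ij => `|v ij.1 ij.2|) (i, 0)).
Qed.

(** Bounds at one point on each side of [0] spread over the segment between them, since [h 0 = 0].
    The scale [d] replaces [|c|] so that all coordinates of a vector can share it. *)
Lemma convex_axis K h v : convex_on K h -> K 0 -> h 0 = 0 ->
  (forall w (e : R), 0 < e ->
    exists t : R, [/\ 0 < t, K (t *: w) & h (t *: w) <= e * t]) ->
  forall e : R, 0 < e -> exists2 t : R, 0 < t &
    forall d c : R, 0 < d -> d <= t -> `|c| <= d -> K (c *: v) /\ h (c *: v) <= e * d.
Proof.
move=> ch K0 h0 hw e e0.
have [t1 [t10 Kt1 ht1]] := hw v e e0.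
have [t2 [t20 Kt2 ht2]] := hw (- v) e e0.
exists (Num.min t1 t2) => [|d c d0]; first by rewrite lt_min t10.
rewrite le_min => /andP[dt1 dt2].
have aux t w b : 0 < t -> K (t *: w) -> h (t *: w) <= e * t -> d <= t -> 0 <= b ->
    b <= d -> K (b *: w) /\ h (b *: w) <= e * d.
  move=> t0 Kt ht dt b0 bd.
  have b01 : 0 <= b / t <= 1.
    by rewrite ler_pdivrMr// mul1r (le_trans bd)// andbT divr_ge0// ltW.
  have [] := ch _ _ _ Kt K0 b01.
  rewrite scaler0 addr0 h0 mulr0 addr0 scalerA divfK ?gt_eqF// => Kb hb.
  split=> //; apply: (le_trans hb); apply: (le_trans (y := e * b)).
    by rewrite mulrAC ler_pdivrMr// mulrC mulrAC ler_wpM2r.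
  by rewrite ler_pM2l.
have [c0|c0] := leP 0 c; [rewrite ger0_norm// => cd|rewrite ltr0_norm// => cd].
  exact: (aux t1).
rewrite -[c]opprK scaleNr -scalerN; apply: (aux t2) => //.
by rewrite oppr_ge0 ltW.
Qed.

(* Axis by axis: [h] at the midpoint of [2 a] and [2 b] is at most the average
   of its values there, so the bound passes from [a] and [b] to [a + b]. *)
Lemma convex_littleo K h : convex_on K h -> K 0 -> h 0 = 0 ->
  (forall w (e : R), 0 < e ->
    exists t : R, [/\ 0 < t, K (t *: w) & h (t *: w) <= e * t]) ->
  forall e : R, 0 < e -> \forall v \near (0 : 'cV[R]_n), h v <= e * `|v|.
Proof.
move=> ch K0 h0 hw.
have main (s : seq 'I_n) : forall e : R, 0 < e -> exists2 t : R, 0 < t &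
    forall (d : R) (c : 'cV[R]_n), 0 < d -> d <= t -> (forall i, `|c i 0| <= d) ->
    K (\sum_(i <- s) c i 0 *: delta_mx i 0) /\
    h (\sum_(i <- s) c i 0 *: delta_mx i 0) <= e * d.
  elim: s => [|i s IH] e e0.
    by exists 1 => // d c d0 _ _; rewrite big_nil h0 mulr_ge0// ltW.
  (* The doubled vectors live at scale [2 d], so the tolerance [e / 2] yields [e * d] again. *)
  have e20 : 0 < e / 2 by rewrite divr_gt0.
  have [t1 t10 ht1] := IH _ e20.
  have [t2 t20 ht2] := convex_axis K h (delta_mx i 0) ch K0 h0 hw _ e20.
  exists (Num.min t1 t2 / 2) => [|d c d0]; first by rewrite divr_gt0// lt_min t10.
  rewrite ler_pdivlMr// le_min => /andP[dt1 dt2] cd; rewrite big_cons.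
  have d20 : 0 < d * 2 by rewrite mulr_gt0.
  have c2 j : `|(2 *: c) j 0| <= d * 2.
    by rewrite mxE normrM mulrC normr_nat ler_pM2r.
  have [Ks hs] := ht1 _ (2 *: c) d20 dt1 c2.
  have [Ki hi] := ht2 _ _ d20 dt2 (c2 i).
  have l2 : 0 <= (2^-1 : R) <= 1 by lra.
  have [] := ch _ _ _ Ki Ks l2.
  have -> : 2^-1 *: ((2 *: c) i 0 *: delta_mx i 0) +
    (1 - 2^-1) *: (\sum_(j <- s) (2 *: c) j 0 *: delta_mx j 0) =
    c i 0 *: delta_mx i 0 + \sum_(j <- s) c j 0 *: delta_mx j 0 :> 'cV[R]_n.
    rewrite scaler_sumr; congr (_ + _); last apply: eq_bigr => j _.
      by rewrite scalerA mxE mulrA mulVf// mul1r.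
    by rewrite scalerA mxE mulrA (_ : (1 - 2^-1) * 2 = 1) ?mul1r//; lra.
  by move=> ? ?; split=> //; lra.
move=> e e0; have [t t0 ht] := main (enum 'I_n) e e0.
(* The sup norm bounds every coordinate, so the scale [d] can be [|v|], once it is positive. *)
near=> v; have [->|v0] := eqVneq v 0; first by rewrite h0 normr0 mulr0.
have nv0 : 0 < `|v| by rewrite normr_gt0.
have [||_] := ht `|v| v nv0.
- near: v; exact: (@nbhs0_le _ 'cV[R]_n t t0).
- move=> i. exact: (normr_coord_le v i).
by rewrite big_enum/= -col_sum_delta.
Unshelve. all: by end_near. Qed.
End Convex_littleo.

(** * Linear forms as differentials, and a differentiability criterion *)

Section Dot_differential.
Context {R : realType} {n : nat}.
Implicit Types (a x v : 'cV[R]_n).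

Fact dot_is_linear a : linear (dot a : 'cV[R]_n -> R).
Proof. by move=> t x y; rewrite dotDr dotZr. Qed.

HB.instance Definition _ a :=
  GRing.isLinear.Build R 'cV[R]_n R _ (dot a) (dot_is_linear a).

Lemma differentiable_dot a x : differentiable (dot a) x.
Proof.
have -> : dot a = \sum_(i < n) (a i 0 *: (fun y : 'cV[R]_n => y i 0)).
  by apply/funext => y; rewrite fct_sumE.
apply: differentiable_sum => i; apply: differentiableZ.
exact: differentiable_coord.
Qed.

Lemma continuous_dot a : continuous (dot a).
Proof. by move=> x; apply/differentiable_continuous/differentiable_dot. Qed.

Lemma derive_dot a x v : 'D_v (dot a) x = dot a v.
Proof.
rewrite deriveE; last exact: differentiable_dot.
by rewrite diff_lin//; exact: continuous_dot.
Qed.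

Lemma differentiable_dot_littleo (g : 'cV[R]_n -> R) p : g 0 = 0 ->
  (forall e : R, 0 < e ->
    \forall v \near (0 : 'cV[R]_n), `|g v - dot p v| <= e * `|v|) ->
  differentiable g 0.
Proof.
move=> g0 gp.
have gE : g \o shift 0 = cst (g 0) + dot p +o_ (0 : 'cV[R]_n) id.
  apply/eqaddoP => e e0; near=> v.
  rewrite /= !fctE /= g0 add0r addr0; near: v; exact: gp.
have dgE := diff_unique (@continuous_dot p) gE.
apply/diff_locallyP; split; last by rewrite dgE.
by rewrite dgE; exact: continuous_dot.
Unshelve. all: by end_near. Qed.

(** The hypothesis on opposite directions forces a supporting [p] to equal the directional
    derivative. Then [g - <p, .>] is convex, nonnegative on [K], and has arbitrarily small slopes
    along every ray, hence is a little-o. *)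
Lemma convex_differentiable (K : set 'cV[R]_n) (g : 'cV[R]_n -> R) :
  convex_on K g -> nbhs (0 : 'cV[R]_n) K ->
  g 0 = 0 -> (forall v, inf (slopes K g v) + inf (slopes K g (- v)) <= 0) ->
  differentiable g 0.
Proof.
move=> cg K0 g0 Pv; have KK0 := nbhs_singleton K0.
have [Slb sP] := inf_slopes_sublinear _ _ cg K0 g0.
have [p [pP _]] := sublinear_support _ 0 sP.
have Pp v : inf (slopes K g v) <= dot p v.
  by have := pP (- v); have := Pv v; rewrite dotNr; lra.
have gp v : K v -> dot p v <= g v.
  move=> Kv; apply: le_trans (pP v) _; apply: ge_inf; first exact: (Slb v).2.
  (* The step [t = 1] is admissible because [v] itself lies in [K]. *)
  by exists 1; [split; rewrite ?scale1r|rewrite scale1r divr1].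
apply: (@differentiable_dot_littleo _ p) => // e e0.
have : \forall v \near (0 : 'cV[R]_n), g v - dot p v <= e * `|v|.
  apply: (convex_littleo K (fun v => g v - dot p v)) => //.
  - move=> x y l Kx Ky l01; have [Kl gl] := cg _ _ _ Kx Ky l01; split=> //.
    by rewrite dotDr !dotZr; lra.
  - by rewrite g0 dot0r subrr.
  - move=> w d d0; have [_ [t [t0 Kt] <-]] := inf_adherent d0 (Slb w).
    rewrite ltr_pdivrMr// => gt; exists t; split=> //.
    have := Pp w; rewrite dotZr => /(ler_wpM2l (ltW t0)).
    by move: gt; rewrite mulrDl; lra.
apply: filterS2 K0 => v Kv hv; rewrite ger0_norm//.
by rewrite subr_ge0 gp.
Qed.

End Dot_differential.

(** * Quadratic polynomials as test functions *)

Section Quadratic.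
Context {R : realType} {n : nat}.
Implicit Types (a b x v : 'cV[R]_n) (A : 'M[R]_n) (Omega : set 'cV[R]_n).

Definition affine a (c : R) x0 x : R := dot a (x - x0) + c.

Lemma affineE a c x0 : affine a c x0 = dot a + cst (c - dot a x0).
Proof.
by apply/funext => x; rewrite /affine dotBr fctE /= addrAC -addrA [c - _]addrC.
Qed.

Lemma differentiable_affine a c x0 x : differentiable (affine a c x0) x.
Proof. by rewrite affineE; apply: differentiableD => //; exact: differentiable_dot. Qed.

Lemma is_derive_affine a c x0 x v : is_derive x v (affine a c x0) (dot a v).
Proof.
apply: DeriveDef; first exact/diff_derivable/differentiable_affine.
rewrite affineE deriveD; last by [].
  by rewrite derive_dot derive_cst addr0.
exact/diff_derivable/differentiable_dot.
Qed.

Lemma partial_affine a c x0 i : partial i (affine a c x0) = cst (a i 0).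
Proof.
apply/funext => x; rewrite /partial.
by rewrite (@derive_val _ _ _ _ _ _ _ (is_derive_affine _ _ _ _ _)) dot_delta.
Qed.

Lemma class_C1_affine Omega a c x0 : class_C 1 Omega (affine a c x0).
Proof.
split=> [x _|i]; first exact: differentiable_affine.
rewrite partial_affine /=; apply: continuous_subspaceT; exact: cst_continuous.
Qed.

Definition quadratic A b x0 x : R :=
  dot b (x - x0) + 2^-1 * dot (A *m (x - x0)) (x - x0).

Lemma dot_symmx A x v : A^T = A -> dot (A *m x) v = dot x (A *m v).
Proof.
move=> AT; rewrite /dot.
under eq_bigr do rewrite mxE mulr_suml.
rewrite exchange_big/=; apply: eq_bigr => i _; rewrite mxE mulr_sumr.
apply: eq_bigr => j _; have -> : A j i = A i j by rewrite -{1}AT mxE.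
by rewrite mulrCA mulrA.
Qed.

(** Products of affine functions bring the quadratic form within reach of the sum and product
    rules. *)
Lemma quadraticE A b x0 : quadratic A b x0 =
  affine b 0 x0 + 2^-1 *:
   \sum_(i < n) (affine (row i A)^T 0 x0 * affine (delta_mx i 0) 0 x0).
Proof.
apply/funext => x; rewrite /quadratic !fctE fct_sumE /affine !addr0.
congr (_ + _ * _); apply: eq_bigr => i _; rewrite !fctE !addr0.
rewrite [X in _ = _ * X]dotC dot_delta; congr (_ * _).
by rewrite mxE; apply: eq_bigr => j _; rewrite !mxE.
Qed.

Lemma differentiable_quadratic A b x0 x : differentiable (quadratic A b x0) x.
Proof.
rewrite quadraticE; apply: differentiableD; first exact: differentiable_affine.
apply: differentiableZ; apply: differentiable_sum => i.
by apply: differentiableM; exact: differentiable_affine.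
Qed.

Lemma derive_quadratic A b x0 x v : A^T = A ->
  'D_v (quadratic A b x0) x = dot b v + dot (A *m v) (x - x0).
Proof.
move=> AT; rewrite quadraticE.
have da a c := is_derive_affine a c x0 x v.
have dM i := is_deriveM (da (row i A)^T 0) (da (delta_mx i 0) 0).
have dZ := is_deriveZ 2^-1 (is_derive_sum dM).
rewrite (@derive_val _ _ _ _ _ _ _ (is_deriveD (da b 0) dZ)); congr (_ + _).
have -> : \sum_(i < n) (affine (row i A)^T 0 x0 x *: dot (delta_mx i 0) v +
    affine (delta_mx i 0) 0 x0 x *: dot (row i A)^T v) =
  dot (A *m (x - x0)) v + dot (A *m v) (x - x0).
  rewrite -big_split; apply: eq_bigr => i _; rewrite /affine !addr0.
  rewrite !(dotC (delta_mx _ _)) !dot_delta /GRing.scale/= !mxE; congr (_ * _ + _).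
    by apply: eq_bigr => j _; rewrite !mxE.
  rewrite mulrC; congr (_ * _).
  by apply: eq_bigr => j _; rewrite !mxE.
by rewrite (dot_symmx _ (x - x0))// [dot (x - x0) _]dotC /GRing.scale/=; lra.
Qed.

Lemma partial_quadratic A b x0 i : A^T = A ->
  partial i (quadratic A b x0) = affine (col i A) (b i 0) x0.
Proof.
move=> AT; apply/funext => x; rewrite /partial derive_quadratic// dot_delta.
by rewrite -colE addrC.
Qed.

Lemma class_C2_quadratic Omega A b x0 : A^T = A ->
  class_C 2 Omega (quadratic A b x0).
Proof.
move=> AT; split=> [x _|i]; first exact: differentiable_quadratic.
by rewrite partial_quadratic//; exact: class_C1_affine.
Qed.

(** At the base point the gradient is [b] and the Hessian is [A]. *)
Lemma infty_laplacian_quadratic A b x0 : A^T = A ->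
  infty_laplacian (quadratic A b x0) x0 = dot (A *m b) b.
Proof.
move=> AT; rewrite /infty_laplacian.
have -> : grad (quadratic A b x0) x0 = b.
  apply/colP => i; rewrite mxE partial_quadratic// /affine subrr dot0r add0r //.
suff -> : hessian (quadratic A b x0) x0 = A by [].
apply/matrixP => i j; rewrite mxE partial_quadratic// partial_affine/= mxE.
by rewrite -[in LHS]AT mxE.
Qed.

End Quadratic.

(** * Uniqueness of the subgradient, and convexity on cubes *)

Section Viscosity.
Context {R : realType} {n : nat}.
Implicit Types (x y v p q : 'cV[R]_n) (Omega K : set 'cV[R]_n) (u : 'cV[R]_n -> R).

Lemma quadratic_scalar (C : R) x0 y :
  quadratic C%:M 0 x0 y = C / 2 * dot (y - x0) (y - x0).
Proof.
by rewrite /quadratic dotC dot0r add0r mul_scalar_mx dotZl; lra.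
Qed.

Lemma viscosity_subgradient_unique Omega f u (C : R) x0 p q :
  viscosity_solution Omega f u -> Omega x0 ->
  (\forall y \near x0, dot p (y - x0) <=
    (quadratic C%:M 0 x0 \- u) y - (quadratic C%:M 0 x0 \- u) x0) ->
  (\forall y \near x0, dot q (y - x0) <=
    (quadratic C%:M 0 x0 \- u) y - (quadratic C%:M 0 x0 \- u) x0) ->
  p = q.
Proof.
move=> [_ uvisc] Ox0 hp hq; apply/eqP/negP => /negP pNq.
pose m := 2^-1 *: (p + q); pose d := 2^-1 *: (p - q).
have dd : dot d d != 0.
  apply: contra pNq => /eqP/dot_eq0/eqP.
  by rewrite scaler_eq0 subr_eq0 invr_eq0 pnatr_eq0.
have [s [sle sge bd]] : exists s : R, [/\ s <= 2^-1, - 2^-1 <= s &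
    dot d (s *: d - m) != 0].
  have [md|md] := eqVneq (dot d m) 0; [exists 2^-1|exists 0].
    split; [by []|lra|]; rewrite dotBr dotZr md subr0 mulf_neq0//.
  by split; [lra|lra|]; rewrite dotBr dotZr mul0r sub0r oppr_eq0.
set b := s *: d - m in bd.
set F := f x0 (u x0); pose k := (`|F + C * dot b b| + 1) / (dot d b ^+ 2).
have k0 : 0 < k.
  by rewrite divr_gt0 ?ltr_wpDl// lt_neqAle eq_sym sqrf_eq0 bd sqr_ge0.
pose A : 'M[R]_n := C%:M - k *: (d *m d^T).
have AE v : dot (A *m v) v = C * dot v v - k * dot d v ^+ 2.
  rewrite mulmxBl dotBl mul_scalar_mx dotZl -scalemxAl dotZl dot_mulmx_trmx.
  by rewrite expr2.
have AT : A^T = A.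
  by rewrite /A linearB/= linearZ/= tr_scalar_mx trmx_mul trmxK.
have [/(_ _) + _] := uvisc x0 (quadratic A b x0) Ox0 (class_C2_quadratic _ _ _ _ AT).
rewrite infty_laplacian_quadratic// AE => hmax.
suff /hmax : has_local_max (u \- quadratic A b x0) x0.
  rewrite divfK ?sqrf_eq0// -/F.
  by have := ler_norm (F + C * dot b b); lra.
have small : \forall y \near x0, `|dot d (y - x0)| <= k^-1.
  have := differentiable_continuous (differentiable_affine d 0 x0 x0).
  rewrite /prop_for /continuous_at/=; rewrite (_ : affine d 0 x0 x0 = 0); last first.
    by rewrite /affine subrr dot0r addr0.
  move=> /cvgr0_norm_le/(_ k^-1); rewrite invr_gt0 => /(_ k0).
  by apply: filterS => y; rewrite /affine addr0.
rewrite /has_local_max; near=> y.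
have : dot p (y - x0) <=
    (quadratic C%:M 0 x0 \- u) y - (quadratic C%:M 0 x0 \- u) x0 by near: y.
have : dot q (y - x0) <=
    (quadratic C%:M 0 x0 \- u) y - (quadratic C%:M 0 x0 \- u) x0 by near: y.
have : `|dot d (y - x0)| <= k^-1 by near: y.
rewrite /= !quadratic_scalar /quadratic !AE subrr !dot0r.
set v := y - x0.
have -> : dot p v = dot m v + dot d v.
  by rewrite -dotDl; congr dot; apply/colP => i; rewrite !mxE; lra.
have -> : dot q v = dot m v - dot d v.
  by rewrite -dotBl; congr dot; apply/colP => i; rewrite !mxE; lra.
have -> : dot b v = s * dot d v - dot m v by rewrite -dotZl -dotBl.
move: (dot d v) (dot m v) (dot v v) => z mv vv.
move=> kz; have {}kz : k * z ^+ 2 <= `|z|.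
  rewrite -real_normK ?num_real// expr2 mulrA ler_piMl//.
  by rewrite -ler_pdivlMl// mulr1.
have sz : - (2^-1 * `|z|) <= s * z.
  have sn : `|s| <= 2^-1 by rewrite ler_norml sge.
  rewrite lerNl -mulNr (le_trans (ler_norm _))// normrM normrN.
  by rewrite ler_wpM2r.
have [z0|z0] := leP 0 z;
  move: kz sz; rewrite ?(ger0_norm z0) ?(ltr0_norm z0); lra.
Unshelve. all: by end_near. Qed.

(* The sup-norm ball, in coordinates because compactness is only available
   coordinatewise. *)
Definition cube x0 (r : R) : set 'cV[R]_n := [set y | forall i, `|y i 0 - x0 i 0| <= r].

Lemma cube_compact x0 r : compact (cube x0 r).
Proof.
have -> : cube x0 r = trmx @` [set v : 'rV[R]_n |
    forall i, `[x0 i 0 - r, x0 i 0 + r]%classic (v ord0 i)].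
  apply/seteqP; split=> [y xy|_ [v vx <-] i].
    exists y^T; last exact: trmxK.
    by move=> i /=; rewrite mxE in_itv/= -ler_distlC distrC.
  by have := vx i; rewrite /= in_itv/= -ler_distlC distrC mxE.
apply: continuous_compact; last first.
  apply: (@rV_compact _ _ (fun i => `[x0 i 0 - r, x0 i 0 + r]%classic)) => i.
  exact: segment_compact.
apply: continuous_subspaceT => v U /nbhs_ballP[e e0 eU]; apply/nbhs_ballP.
by exists e => // w [_ vw]; apply: eU; split=> // i j; rewrite !mxE.
Qed.

Lemma cube_nbhs x0 r : 0 < r -> nbhs x0 (cube x0 r).
Proof.
move=> r0; apply/nbhs_ballP; exists r => // y [_ xy] i.
by rewrite distrC ltW//; exact: xy.
Qed.

Lemma open_cube Omega x0 : open Omega -> Omega x0 ->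
  exists2 r, 0 < r & cube x0 r `<=` Omega.
Proof.
rewrite openE => oO /oO /nbhs_ballP[r /= r0 rO]; exists (r / 2).
  by rewrite divr_gt0.
move=> y xy; apply: rO; split=> // i j.
rewrite !ord1 /ball/= distrC (le_lt_trans (xy i))// ltr_pdivrMr//. lra.
Qed.

Lemma cube_convex x0 r x y (l : R) : cube x0 r x -> cube x0 r y -> 0 <= l <= 1 ->
  cube x0 r (l *: x + (1 - l) *: y).
Proof.
move=> xr yr /andP[l0 l1] i; have := xr i; have := yr i; rewrite !mxE.
rewrite !ler_norml => /andP[? ?] /andP[? ?]; apply/andP; split; nra.
Qed.

Lemma semiconcave_convex_on K u (C : R) x0 :
  (forall x y (l : R), K x -> K y -> 0 <= l <= 1 -> K (l *: x + (1 - l) *: y)) ->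
  semiconcave C K u -> convex_on K (quadratic C%:M 0 x0 \- u).
Proof.
move=> cK scu x y l Kx Ky l01; split; first exact: cK.
have := scu x y _ l l01; rewrite /= !quadratic_scalar => /(_ _)/wrap[].
  by move=> _ [t /= t01 <-]; exact: cK.
have -> : l *: x + (1 - l) *: y - x0 = l *: (x - x0) + (1 - l) *: (y - x0).
  rewrite !scalerBr addrACA -opprD -scalerDl; congr (_ - _).
  by rewrite addrC subrK scale1r.
have -> : x - y = (x - x0) - (y - x0) by rewrite opprB subrKA.
move: (x - x0) (y - x0) => v w.
rewrite !(dotBl, dotBr, dotDl, dotDr, dotZl, dotZr) (dotC w v).
move: (dot v v) (dot v w) (dot w w) => a b c; nra.
Qed.

Lemma convex_on_shift K (w : 'cV[R]_n -> R) x0 : convex_on K w ->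
  convex_on [set v | K (v + x0)] (fun v => w (v + x0) - w x0).
Proof.
move=> cw x y l /= Kx Ky l01; have [] := cw _ _ _ Kx Ky l01.
have -> : l *: (x + x0) + (1 - l) *: (y + x0) = l *: x + (1 - l) *: y + x0.
  by rewrite !scalerDr addrACA -scalerDl subrKC scale1r.
by move=> ? ?; split=> //; lra.
Qed.

End Viscosity.

Section Regularity.
Context {R : realType} {n : nat}.
Implicit Types (x y v : 'cV[R]_n) (Omega K : set 'cV[R]_n) (u w : 'cV[R]_n -> R).

Lemma nbhs_shift (P : set 'cV[R]_n) x y : nbhs (y + x) P ->
  \forall z \near y, P (z + x).
Proof.
move=> nP; have : \forall z \near y + x, P z by [].
by rewrite (near_shift y) [y + x]addrC addrK.
Qed.

Lemma locally_semiconcave_convex_on Omega u x0 : open Omega -> Omega x0 ->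
  locally_semiconcave Omega u -> exists C K,
  [/\ nbhs x0 K, K `<=` Omega & convex_on K (quadratic C%:M 0 x0 \- u)].
Proof.
move=> oO Ox0 scu; have [r r0 rO] := open_cube _ _ oO Ox0.
have [C sc] := scu _ (cube_compact x0 r) rO.
exists C, (cube x0 r); split=> //; first exact: cube_nbhs.
by apply: semiconcave_convex_on sc; exact: cube_convex.
Qed.

Lemma viscosity_semiconcave_differentiable Omega f u x0 : open Omega ->
  viscosity_solution Omega f u -> locally_semiconcave Omega u ->
  Omega x0 -> differentiable u x0.
Proof.
move=> oO visc scu Ox0.
have [C [K [nK KO cK]]] := locally_semiconcave_convex_on _ _ _ oO Ox0 scu.
set w := _ \- u in cK.
have cg := convex_on_shift _ _ x0 cK.
set K' := [set v | _] in cg; set g := (fun v => _) in cg.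
have nK' : nbhs (0 : 'cV[R]_n) K'.
  by apply: nbhs_shift; rewrite add0r.
have g0 : g 0 = 0 by rewrite /g add0r subrr.
have [Pinf sP] := inf_slopes_sublinear _ _ cg nK' g0.
have support p : (forall v, dot p v <= inf (slopes K' g v)) ->
    \forall y \near x0, dot p (y - x0) <= w y - w x0.
  move=> pP; apply: filterS nK => y Ky; apply: le_trans (pP _) _.
  apply: ge_inf; first exact: (Pinf _).2.
  exists 1; first by split=> //; rewrite /K' scale1r /= subrK.
  by rewrite scale1r divr1 /g subrK.
have dg : differentiable g 0.
  apply: (convex_differentiable K') => // v.
  have [p [pP pv]] := sublinear_support _ v sP.
  have [q [qP qv]] := sublinear_support _ (- v) sP.
  have pq := viscosity_subgradient_unique _ _ _ _ _ _ _ visc Ox0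
    (support _ pP) (support _ qP).
  by rewrite -pv -qv pq dotNr subrr.
have -> : u = quadratic C%:M 0 x0 - (g \o (fun y => y - x0) + cst (w x0)).
  apply/funext => y; rewrite !fctE /= /g subrK subrK /w.
  by rewrite /= opprB addrC subrK.
apply: differentiableB; first exact: differentiable_quadratic.
apply: differentiableD; last exact: differentiable_cst.
apply: differentiable_comp; last by rewrite subrr.
by apply: differentiableB => //; exact: differentiable_cst.
Qed.

Lemma convex_derive_usc K w x v : convex_on K w -> nbhs x K ->
  (forall y, K y -> differentiable w y) -> forall e : R, 0 < e ->
  \forall y \near x, 'D_v w y <= 'D_v w x + e.
Proof.
move=> cw nK dw e e0.
have Kx := nbhs_singleton nK.
have dwx : derivable w x v by exact/diff_derivable/dw.
have tx : \forall t \near (0 : R)^'+, nbhs (t *: v + x) K.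
  have /cvg_at_right_filter : (t *: v) @[t --> (0 : R)] --> (0 : 'cV[R]_n).
    by rewrite -[X in _ --> X](scale0r v); exact: scalel_continuous.
  move=> /(_ [set z | nbhs (z + x) K]); apply.
  have : nbhs x K° by exact: nbhs_interior.
  by rewrite -{1}[x]add0r; exact: nbhs_shift.
have wt : \forall t \near (0 : R)^'+,
    (w (t *: v + x) - w x) / t <= 'D_v w x + e / 2.
  have /cvg_dnbhs_at_right dwx' := dwx.
  have e20 : 0 < e / 2 by rewrite divr_gt0.
  have {}dwx' := cvgr_dist_le _ _ dwx' _ e20.
  near=> t; rewrite mulrC -lerBlDl.
  apply: le_trans (ler_norm _) _; rewrite distrC.
  by near: t; exact: dwx'.
have [t [t0 nKt {}wt]] : exists t : R,
    [/\ 0 < t, nbhs (t *: v + x) K & (w (t *: v + x) - w x) / t <= 'D_v w x + e / 2].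
  near (0 : R)^'+ => t; exists t; split; near: t; first exact: nbhs_right_gt.
    exact: tx.
  exact: wt.
have Kt := nbhs_singleton nKt.
have et0 : 0 < e / 4 * t by rewrite mulr_gt0// divr_gt0.
have close z : K z -> \forall y \near z, `|w z - w y| <= e / 4 * t.
  by move=> /dw/differentiable_continuous/cvgr_dist_le; exact.
have cwx := close _ Kx; have cwt := close _ Kt.
move: nKt cwt; rewrite addrC => nKt cwt.
have {}nKt := nbhs_shift _ _ _ nKt; have {}cwt := nbhs_shift _ _ _ cwt.
near=> y.
have Ky : K y by near: y.
have Kyt : K (y + t *: v) by near: y.
have dwy : derivable w y v by exact/diff_derivable/dw.
apply: le_trans (convex_derive_le _ _ _ _ _ cw dwy t0 Ky Kyt) _.
rewrite ler_pdivrMr//; move: wt; rewrite ler_pdivrMr// [t *: v + x]addrC.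
have : `|w x - w y| <= e / 4 * t by near: y.
have : `|w (x + t *: v) - w (y + t *: v)| <= e / 4 * t by near: y.
rewrite !ler_norml => /andP[? ?] /andP[? ?]; nra.
Unshelve. all: by end_near. Qed.

Lemma convex_derive_continuous K w x v : convex_on K w -> nbhs x K ->
  (forall y, K y -> differentiable w y) -> {for x, continuous ('D_v w)}.
Proof.
move=> cw nK dw; rewrite /prop_for /continuous_at.
apply/(@cvgrPdist_le R R _ (nbhs x)) => e e0; have Kx := nbhs_singleton nK.
have := convex_derive_usc _ _ _ (- v) cw nK dw _ e0.
have := convex_derive_usc _ _ _ v cw nK dw _ e0.
apply: filterS3 nK => y Ky.
have DN z : K z -> 'D_(- v) w z = - 'D_v w z.
  by move=> Kz; rewrite !deriveE ?linearN//; exact: dw.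
rewrite !DN//.
by move=> ? ?; rewrite ler_norml; apply/andP; split; lra.
Qed.

Lemma semiconcave_differentiable_C1 Omega u : open Omega ->
  locally_semiconcave Omega u -> (forall x, Omega x -> differentiable u x) ->
  class_C 1 Omega u.
Proof.
move=> oO scu du; split=> // i /=; rewrite continuous_open_subspace// => x.
move=> /set_mem Ox.
have [C [K [nK KO cK]]] := locally_semiconcave_convex_on _ _ _ oO Ox scu.
have dw y : K y -> differentiable (quadratic C%:M 0 x \- u) y.
  move=> /KO/du ?; apply: differentiableB => //; exact: differentiable_quadratic.
have cD := convex_derive_continuous _ _ _ (delta_mx i 0) cK nK dw.
have CT : (C%:M : 'M[R]_n)^T = C%:M by rewrite tr_scalar_mx.
have nE : {near nbhs x, partial i (quadratic C%:M 0 x) \-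
    'D_(delta_mx i 0) (quadratic C%:M 0 x \- u) =1 partial i u}.
  apply: filterS nK => y /KO/du dy; rewrite /= deriveB.
  - by rewrite opprB addrC subrK.
  - exact/diff_derivable/differentiable_quadratic.
  - exact/diff_derivable.
rewrite /prop_for /continuous_at -(nbhs_singleton nE).
apply: cvg_trans (near_eq_cvg nE) _.
apply: cvgB cD; rewrite partial_quadratic//.
exact/differentiable_continuous/differentiable_affine.
Qed.

End Regularity.

Theorem theorem10 (R : realType) (n : nat) (Omega : set 'cV[R]_n)
    (f : 'cV[R]_n -> R -> R) (u : 'cV[R]_n -> R) :
  Omega !=set0 -> open Omega -> bounded_set Omega ->
  viscosity_solution Omega f u ->
  locally_semiconcave Omega u ->
  (forall x, Omega x -> differentiable u x) /\ class_C 1 Omega u.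
Proof.
move=> _ oO _ visc scu.
have du x (Ox : Omega x) := viscosity_semiconcave_differentiable _ _ _ _ oO visc scu Ox.
by split=> //; exact: semiconcave_differentiable_C1.
Qed.
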